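(* Let $H=\mathcal{K}\,\triangleright\!\!\!\blacktriangleleft\mathcal{L}$ be a bicrossproduct Hopf algebra over $\mathbb{C}$ with $\mathcal{K}$ cocommutative and $\mathcal{L}$ commutative, with generators $k_1,\dots,k_r$ of $\mathcal{K}$ and $l_1,\dots,l_s$ of $\mathcal{L}$ and dual generators $\kappa_1,\dots,\kappa_r$, $\lambda_1,\dots,\lambda_s$ as described in the context. Let $a\in\mathbb{C}^s$ and consider the character of $\mathcal{L}$ given by $$1\dashv l_n=a_n:=a_1^{n_1}\cdots a_s^{n_s},\qquad n\in\mathbb{N}^s .$$ Then the carrier space $\mathbb{C}^\uparrow$ of the representation of $H$ induced by this character is isomorphic to $\mathcal{K}^*$ and consists of the elements of the form $\kappa\psi$, where $\kappa\in\mathcal{K}^*$ and $$\psi=e^{a_1\lambda_1}e^{a_2\lambda_2}\cdots e^{a_s\lambda_s}.$$ The induced action is given by $$f\dashv h=\sum_{m\in\mathbb{N}^r}\kappa^m\Big\langle h\,\frac{k_m}{m!},f\Big\rangle\psi,\qquad h\in H,\ f\in\mathbb{C}^\uparrow.$$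
   Context: Bicrossproduct: $\mathcal{L}$ is a right $\mathcal{K}$-module algebra (action $\triangleleft$) and $\mathcal{K}$ a left $\mathcal{L}$-comodule coalgebra (coaction $k\mapsto k^{(1)}\otimes k^{(2)}\in\mathcal{L}\otimes\mathcal{K}$), with the usual compatibility conditions making $H=\mathcal{K}\otimes\mathcal{L}$ (write $kl=k\otimes l$) a Hopf algebra with product $(k\otimes l)(k'\otimes l')=kk'_{(1)}\otimes(l\triangleleft k'_{(2)})l'$ and coproduct $\Delta(k\otimes l)=k_{(1)}\otimes{k_{(2)}}^{(1)}l_{(1)}\otimes{k_{(2)}}^{(2)}\otimes l_{(2)}$. In particular $\mathcal{K}$ and $\mathcal{L}$ are subalgebras of $H$. Multi-index notation: $k_m=k_1^{m_1}\cdots k_r^{m_r}$, $l_n=l_1^{n_1}\cdots l_s^{n_s}$, $\kappa^m=\kappa_1^{m_1}\cdots\kappa_r^{m_r}$, $\lambda^n=\lambda_1^{n_1}\cdots\lambda_s^{n_s}$, $m!=\prod_i m_i!$, $\delta^{m'}_m=\prod_i\delta^{m'_i}_{m_i}$; $\mathbb{N}$ contains $0$. Standing assumptions: $\mathcal{K}$ is generated by primitive elements $k_1,\dots,k_r$ (i.e. $\Delta(k_i)=k_i\otimes1+1\otimes k_i$ in $\mathcal{K}$), $\mathcal{L}$ is generated by $l_1,\dots,l_s$; $(k_m)_{m\in\mathbb{N}^r}$ and $(l_n)_{n\in\mathbb{N}^s}$ are vector space bases of $\mathcal{K}$ and $\mathcal{L}$. The duals $\mathcal{K}^*$, $\mathcal{L}^*$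 have generators $\kappa_1,\dots,\kappa_r$ and $\lambda_1,\dots,\lambda_s$, whose ordered monomials are bases, and the duality between $H$ and $H^*$ is $\langle k_ml_n,\kappa^{m'}\lambda^{n'}\rangle=m!\,n!\,\delta_m^{m'}\delta_n^{n'}$. Linear functionals on $H$ are identified, via this pairing, with (formal, possibly infinite) series $\sum f_{mn}\kappa^m\lambda^n$, so that $\mathrm{Hom}_{\mathbb{C}}(H,\mathbb{C})$ is identified with $H^*$; likewise functionals on $\mathcal{K}$ are identified with formal series $\sum_m f_m\kappa^m$, i.e. with $\mathcal{K}^*$. Induced representation: $\mathbb{C}^\uparrow=\mathrm{Hom}_{\mathcal{L}}(H,\mathbb{C})$ is the space of $f\in\mathrm{Hom}_{\mathbb{C}}(H,\mathbb{C})$ with $f(hl)=f(h)\dashv l$, i.e. $f(hl)$ equals $f(h)$ times the value of the character at $l$, for all $h\in H$, $l\in\mathcal{L}$; the right action of $H$ on $\mathbb{C}^\uparrow$ is $\langle f\dashv h,h'\rangle=\langle f,hh'\rangle$ for $h,h'\in H$. The symbol $\langle h,f\rangle$ is the value of the functional $f$ at $h$. *)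

(* Defs.v *)
From HB Require Import structures.
From mathcomp Require Import all_boot all_order all_algebra.
From mathcomp Require Import generic_quotient sesquilinear finmap.
From mathcomp Require Import all_classical all_reals.
From mathcomp Require Import complex.

Set Implicit Arguments.
Unset Strict Implicit.
Unset Printing Implicit Defensive.

Import GRing.Theory.
Local Open Scope ring_scope.
Local Open Scope quotient_scope.

(* Tensor products.  A formal sum of pure tensors is a list of pairs (a scalar
   is absorbed into either factor), and V \ox W is the quotient of these lists
   by the congruence generated by bilinearity. *)

Section Tensor.
Variables (F : fieldType) (V W : lmodType F).

Inductive teq : seq (V * W) -> seq (V * W) -> Prop :=
| teq_refl s : teq s s
| teq_sym s t : teq s t -> teq t s
| teq_trans s t u : teq s t -> teq t u -> teq s u
| teq_cat s s' t t' : teq s s' -> teq t t' -> teq (s ++ t) (s' ++ t')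
| teq_catC s t : teq (s ++ t) (t ++ s)
| teq0 w : teq [:: (0, w)] [::]
| teqDl v v' w : teq [:: (v + v', w)] [:: (v, w); (v', w)]
| teqDr v w w' : teq [:: (v, w + w')] [:: (v, w); (v, w')]
| teqZ a v w : teq [:: (a *: v, w)] [:: (v, a *: w)].

Definition teqb (s t : seq (V * W)) : bool := `[< teq s t >].

Fact teqb_equiv : equiv_class_of teqb.
Proof.
split=> [s|s t|t s u].
- by apply/asboolP; exact: teq_refl.
- by apply/asboolP/asboolP; exact: teq_sym.
- by move=> /asboolP st /asboolP tu; apply/asboolP; exact: teq_trans st tu.
Qed.
Canonical teqb_equiv_rel := EquivRelPack teqb_equiv.

Definition tensor := {eq_quot teqb}.
HB.instance Definition _ := Choice.on tensor.

Lemma tensorP s t : teq s t <-> \pi_tensor s = \pi_tensor t.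
Proof.
split=> [st|/eqmodP/asboolP//].
by apply/eqmodP/asboolP.
Qed.

Lemma tensor_ind (P : tensor -> Prop) :
  (forall s, P (\pi_tensor s)) -> forall t, P t.
Proof. by move=> Ppi t; have := Ppi (repr t); rewrite reprK. Qed.

Lemma teq_repr s : teq (repr (\pi_tensor s)) s.
Proof. by apply/tensorP; rewrite reprK. Qed.

Definition pure (v : V) (w : W) : tensor := \pi_tensor [:: (v, w)].

Definition tensor_scale_seq (a : F) (s : seq (V * W)) :=
  [seq (a *: p.1, p.2) | p <- s].

Definition tensor0 : tensor := \pi_tensor [::].
Definition tensor_add (s t : tensor) : tensor := \pi_tensor (repr s ++ repr t).
Definition tensor_scale (a : F) (t : tensor) : tensor :=
  \pi_tensor (tensor_scale_seq a (repr t)).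
Definition tensor_opp : tensor -> tensor := tensor_scale (-1).

Lemma teq_scale a s t :
  teq s t -> teq (tensor_scale_seq a s) (tensor_scale_seq a t).
Proof.
elim=> {s t} [s|s t _|s t u _ st _ tu|s s' t t' _ ss' _ tt'|s t|w|v v' w|
  v w w'|b v w] /=.
- exact: teq_refl.
- exact: teq_sym.
- exact: teq_trans st tu.
- by rewrite /tensor_scale_seq !map_cat; exact: teq_cat.
- by rewrite /tensor_scale_seq !map_cat; exact: teq_catC.
- by rewrite scaler0; exact: teq0.
- by rewrite scalerDr; exact: teqDl.
- exact: teqDr.
- by rewrite scalerA mulrC -scalerA; exact: teqZ.
Qed.

Lemma tensor_addE s t :
  tensor_add (\pi_tensor s) (\pi_tensor t) = \pi_tensor (s ++ t).
Proof. by apply/tensorP; apply: teq_cat; exact: teq_repr. Qed.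

Lemma tensor_scaleE a s :
  tensor_scale a (\pi_tensor s) = \pi_tensor (tensor_scale_seq a s).
Proof. by apply/tensorP; apply: teq_scale; exact: teq_repr. Qed.

Lemma teq_scale0 s : teq (tensor_scale_seq 0 s) [::].
Proof.
elim: s => [|[v w] s IH]; first exact: teq_refl.
by rewrite /= scale0r; apply: (@teq_cat [:: _] [::] _ [::] (teq0 _) IH).
Qed.

Lemma teq_scaleD a b s :
  teq (tensor_scale_seq (a + b) s) (tensor_scale_seq a s ++ tensor_scale_seq b s).
Proof.
elim: s => [|[v w] s IH]; first exact: teq_refl.
rewrite /= scalerDl.
apply: teq_trans (teq_cat (teqDl _ _ _) IH) _ => /=.
apply: (@teq_cat [:: _] [:: _] _ _ (teq_refl _)).
rewrite -/(tensor_scale_seq a s) -/(tensor_scale_seq b s).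
set x := (b *: v, w); set sa := tensor_scale_seq a s.
set sb := tensor_scale_seq b s.
rewrite -[x :: sa ++ _]/(([:: x] ++ sa) ++ _) -[x :: sb]/([:: x] ++ sb) [sa ++ _]catA.
by apply: teq_cat; [exact: teq_catC|exact: teq_refl].
Qed.

Fact tensor_addA : associative tensor_add.
Proof.
elim/tensor_ind=> s; elim/tensor_ind=> t; elim/tensor_ind=> u.
by rewrite !tensor_addE catA.
Qed.

Fact tensor_addC : commutative tensor_add.
Proof.
elim/tensor_ind=> s; elim/tensor_ind=> t; rewrite !tensor_addE.
by apply/tensorP; exact: teq_catC.
Qed.

Fact tensor_add0 : left_id tensor0 tensor_add.
Proof. by elim/tensor_ind=> s; rewrite tensor_addE. Qed.

Fact tensor_scale1 : left_id 1 tensor_scale.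
Proof.
elim/tensor_ind=> s; rewrite tensor_scaleE; congr (\pi_tensor _).
by rewrite /tensor_scale_seq -[RHS]map_id; apply: eq_map => -[v w]; rewrite scale1r.
Qed.

Fact tensor_scaleDl t : {morph tensor_scale^~ t : a b / a + b >-> tensor_add a b}.
Proof.
move=> a b; elim/tensor_ind: t => t; rewrite !tensor_scaleE tensor_addE.
by apply/tensorP; exact: teq_scaleD.
Qed.

Fact tensor_addN : left_inverse tensor0 tensor_opp tensor_add.
Proof.
move=> t; rewrite -{2}[t]tensor_scale1 -tensor_scaleDl addNr.
by elim/tensor_ind: t => t; rewrite tensor_scaleE; apply/tensorP; exact: teq_scale0.
Qed.

HB.instance Definition _ :=
  GRing.isZmodule.Build tensor tensor_addA tensor_addC tensor_add0 tensor_addN.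

Fact tensor_scaleA a b t :
  tensor_scale a (tensor_scale b t) = tensor_scale (a * b) t.
Proof.
elim/tensor_ind: t => t; rewrite !tensor_scaleE; congr (\pi_tensor _).
by rewrite /tensor_scale_seq -map_comp; apply: eq_map => p /=; rewrite scalerA.
Qed.

Fact tensor_scaleDr : right_distributive tensor_scale tensor_add.
Proof.
move=> a; elim/tensor_ind=> s; elim/tensor_ind=> t.
by rewrite tensor_addE !tensor_scaleE tensor_addE /tensor_scale_seq map_cat.
Qed.

HB.instance Definition _ := GRing.Zmodule_isLmodule.Build F tensor
  tensor_scaleA tensor_scale1 tensor_scaleDr tensor_scaleDl.

Lemma tensor_add_pi s t :
  (\pi_tensor s : tensor) + \pi_tensor t = \pi_tensor (s ++ t).
Proof. exact: tensor_addE. Qed.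

Lemma tensor_scale_pi a s :
  a *: (\pi_tensor s : tensor) = \pi_tensor (tensor_scale_seq a s).
Proof. exact: tensor_scaleE. Qed.

(* Sweedler notation: the sum of f over a chosen representative of t.  It does
   not depend on the representative as soon as f is bilinear (tsum_pi), so
   that tsum f is then the linear map induced by f. *)
Definition tsum (U : zmodType) (f : V -> W -> U) (t : tensor) : U :=
  \sum_(p <- repr t) f p.1 p.2.

Section Lift.
Variables (U : lmodType F) (f : V -> W -> U).
Hypothesis bilf : bilinear_for *:%R *:%R f.

Let fl w : linear (f^~ w) := bilf.1 w.
Let fr v : linear (f v) := bilf.2 v.

Let f0l w : f 0 w = 0.
Proof.
have := fl w 1 0 0; rewrite /= !scale1r addr0 => /(congr1 (fun x => x - f 0 w)).
by rewrite addrK subrr => <-.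
Qed.

Let f0r v : f v 0 = 0.
Proof.
have := fr v 1 0 0; rewrite /= !scale1r addr0 => /(congr1 (fun x => x - f v 0)).
by rewrite addrK subrr => <-.
Qed.

Lemma teq_sum s t : teq s t ->
  \sum_(p <- s) f p.1 p.2 = \sum_(p <- t) f p.1 p.2.
Proof.
elim=> {s t} [//|//|s t u _ -> //|s s' t t' _ ss' _ tt'|s t|w|v v' w|
  v w w'|b v w].
- by rewrite !big_cat /= ss' tt'.
- by rewrite !big_cat /= addrC.
- by rewrite big_seq1 big_nil f0l.
- by rewrite big_seq1 big_cons big_seq1 /=; have := fl w 1 v v'; rewrite /= !scale1r.
- by rewrite big_seq1 big_cons big_seq1 /=; have := fr v 1 w w'; rewrite /= !scale1r.
- rewrite !big_seq1 /=; have := fl w b v 0; have := fr v b w 0.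
  by rewrite /= !addr0 f0l f0r !addr0 => -> ->.
Qed.

Lemma tsum_pi s : tsum f (\pi_tensor s) = \sum_(p <- s) f p.1 p.2.
Proof. by rewrite /tsum; apply: teq_sum; exact: teq_repr. Qed.

Lemma tsum_pure v w : tsum f (pure v w) = f v w.
Proof. by rewrite /pure tsum_pi big_seq1. Qed.

Lemma tsum_linear : linear (tsum f).
Proof.
move=> a; elim/tensor_ind=> s; elim/tensor_ind=> t.
rewrite tensor_scale_pi tensor_add_pi !tsum_pi big_cat /=.
congr (_ + _); rewrite /tensor_scale_seq big_map scaler_sumr.
apply: eq_bigr => p _ /=; have := fl p.2 a p.1 0.
by rewrite /= addr0 f0l addr0.
Qed.

End Lift.

Lemma pure_bilinear : bilinear_for *:%R *:%R pure.
Proof.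
split=> [w a v v'|v a w w'] /=.
- rewrite /pure tensor_scale_pi tensor_add_pi.
  by apply/tensorP; exact: teqDl.
- rewrite /pure tensor_scale_pi tensor_add_pi; apply/tensorP.
  apply: teq_trans (teqDr _ _ _) _.
  apply: (@teq_cat [:: _] [:: _] [:: _] [:: _]); last exact: teq_refl.
  by apply/teq_sym; exact: teqZ.
Qed.

Lemma tensorE (t : tensor) : t = tsum pure t.
Proof.
elim/tensor_ind: t => s; rewrite (tsum_pi pure_bilinear).
elim: s => [|[v w] s IH]; first by rewrite big_nil.
by rewrite big_cons -IH tensor_add_pi.
Qed.

End Tensor.

Notation "V \ox W" := (tensor V W) (at level 40, left associativity) : type_scope.
Notation "v \ox w" := (pure v w) (at level 40, left associativity) : ring_scope.
Notation "'\tsum_' ( x , y <- t ) E" := (tsum (fun x y => E) t)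
  (at level 36, x name, y name, E at level 36,
   format "'[' '\tsum_' ( x ,  y  <-  t ) '/  '  E ']'") : ring_scope.

Record coalgebra (F : fieldType) (V : lmodType F) := Coalgebra {
  comul : {linear V -> (V \ox V)%type};
  counit : {scalar V};
  coassoc : forall x,
    \tsum_(x1, x2 <- comul x) \tsum_(y1, y2 <- comul x1) (y1 \ox (y2 \ox x2)) =
    \tsum_(x1, x2 <- comul x) \tsum_(y1, y2 <- comul x2) (x1 \ox (y1 \ox y2));
  counitl : forall x, \tsum_(x1, x2 <- comul x) (counit x1 *: x2) = x;
  counitr : forall x, \tsum_(x1, x2 <- comul x) (counit x2 *: x1) = x
}.

Record hopf (F : fieldType) (A : algType F) := Hopf {
  hopf_coalgebra :> coalgebra A;
  comulM : forall x y, comul hopf_coalgebra (x * y) =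
    \tsum_(x1, x2 <- comul hopf_coalgebra x)
      \tsum_(y1, y2 <- comul hopf_coalgebra y) ((x1 * y1) \ox (x2 * y2));
  comul1 : comul hopf_coalgebra 1 = 1 \ox 1;
  counitM : forall x y, counit hopf_coalgebra (x * y) =
    counit hopf_coalgebra x * counit hopf_coalgebra y;
  counit1 : counit hopf_coalgebra 1 = 1;
  antipode : {linear A -> A};
  antipodel : forall x,
    \tsum_(x1, x2 <- comul hopf_coalgebra x) (antipode x1 * x2) =
    counit hopf_coalgebra x *: 1;
  antipoder : forall x,
    \tsum_(x1, x2 <- comul hopf_coalgebra x) (x1 * antipode x2) =
    counit hopf_coalgebra x *: 1
}.

Definition cocommutative (F : fieldType) (V : lmodType F) (C : coalgebra V) :=
  forall x, \tsum_(x1, x2 <- comul C x) (x2 \ox x1) = comul C x.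

Definition primitive (F : fieldType) (A : algType F) (HA : hopf A) (x : A) :=
  comul HA x = x \ox 1 + 1 \ox x.

(* The full linear dual of a coalgebra, as a vector space and as a ring under
   convolution. *)

Definition dual (F : fieldType) (V : lmodType F) (C : coalgebra V) : Type :=
  {scalar V}.

Section Dual.
Variables (F : fieldType) (V : lmodType F) (C : coalgebra V).
Local Notation D := (dual C).

HB.instance Definition _ := gen_eqMixin D.
HB.instance Definition _ := gen_choiceMixin D.

Lemma dualP (f g : D) : (forall x, f x = g x) -> f = g.
Proof.
case: f => f [[f1] [f2]]; case: g => g [[g1] [g2]] /= fg.
have {}fg : f = g by exact/funext.
by subst g; rewrite (Prop_irrelevance f1 g1) (Prop_irrelevance f2 g2).
Qed.

Definition mkdual (f : V -> F) (lf : scalar f) : D :=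
  HB.pack_for {scalar V} f (GRing.isLinear.Build F V F *%R f lf).

Fact dual0_scalar : scalar (fun _ : V => 0 : F).
Proof. by move=> a x y; rewrite mulr0 addr0. Qed.
Fact dualD_scalar (f g : D) : scalar (fun x => f x + g x).
Proof. by move=> a x y; rewrite !linearP mulrDr addrACA. Qed.
Fact dualN_scalar (f : D) : scalar (fun x => - f x).
Proof. by move=> a x y; rewrite linearP opprD mulrN. Qed.
Fact dualZ_scalar (c : F) (f : D) : scalar (fun x => c * f x).
Proof. by move=> a x y; rewrite linearP mulrDr mulrCA. Qed.

Definition dual0 : D := mkdual dual0_scalar.
Definition dualD (f g : D) : D := mkdual (dualD_scalar f g).
Definition dualN (f : D) : D := mkdual (dualN_scalar f).
Definition dualZ (c : F) (f : D) : D := mkdual (dualZ_scalar c f).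

Fact dual_addA : associative dualD.
Proof. by move=> f g h; apply: dualP => x /=; rewrite addrA. Qed.
Fact dual_addC : commutative dualD.
Proof. by move=> f g; apply: dualP => x /=; rewrite addrC. Qed.
Fact dual_add0 : left_id dual0 dualD.
Proof. by move=> f; apply: dualP => x /=; rewrite add0r. Qed.
Fact dual_addN : left_inverse dual0 dualN dualD.
Proof. by move=> f; apply: dualP => x /=; rewrite addNr. Qed.
HB.instance Definition _ :=
  GRing.isZmodule.Build D dual_addA dual_addC dual_add0 dual_addN.

Fact dual_scaleA a b f : dualZ a (dualZ b f) = dualZ (a * b) f.
Proof. by apply: dualP => x /=; rewrite mulrA. Qed.
Fact dual_scale1 : left_id 1 dualZ.
Proof. by move=> f; apply: dualP => x /=; rewrite mul1r. Qed.
Fact dual_scaleDr : right_distributive dualZ +%R.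
Proof. by move=> a f g; apply: dualP => x /=; rewrite mulrDr. Qed.
Fact dual_scaleDl f : {morph dualZ^~ f : a b / a + b}.
Proof. by move=> a b; apply: dualP => x /=; rewrite mulrDl. Qed.
HB.instance Definition _ := GRing.Zmodule_isLmodule.Build F D
  dual_scaleA dual_scale1 dual_scaleDr dual_scaleDl.

Fact dualM_bilinear (f g : D) :
  bilinear_for *:%R *:%R (fun x y => f x * g y : F^o).
Proof.
split=> [y a x x'|x a y y'] /=; rewrite linearP.
- by rewrite mulrDl -mulrA.
- by rewrite mulrDr mulrCA.
Qed.

Fact dualM_scalar (f g : D) :
  scalar (fun x => \tsum_(x1, x2 <- comul C x) (f x1 * g x2)).
Proof.
by move=> a x y; rewrite linearP (tsum_linear (dualM_bilinear f g)).
Qed.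

Definition dualM (f g : D) : D := mkdual (dualM_scalar f g).
Definition dual1 : D := counit C.

Fact dual_mulA : associative dualM.
Proof.
move=> f g h; apply: dualP => x /=.
pose gh y z : F^o := g y * h z.
pose fgh y t : F^o := f y * tsum gh t.
have bfgh : bilinear_for *:%R *:%R fgh.
  split=> [t a y y'|y a t t']; rewrite /fgh /=.
    by rewrite linearP mulrDl -mulrA.
  by rewrite (tsum_linear (dualM_bilinear g h)) mulrDr mulrCA.
have [lin linE] : exists lin : {linear (V \ox (V \ox V))%type -> F^o},
    forall u v w, lin (u \ox (v \ox w)) = f u * (g v * h w).
  exists (HB.pack_for {linear (V \ox (V \ox V))%type -> F^o} (tsum fgh)
    (GRing.isLinear.Build _ _ _ _ (tsum fgh) (tsum_linear bfgh))) => u v w.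
  by rewrite /= (tsum_pure bfgh) /fgh (tsum_pure (dualM_bilinear g h)).
have := congr1 lin (coassoc C x); rewrite /tsum !raddf_sum => E.
transitivity (\sum_(p <- repr (comul C x))
  lin (\sum_(q <- repr (comul C p.2)) (p.1 \ox (q.1 \ox q.2)))).
  apply: eq_bigr => p _; rewrite raddf_sum mulr_sumr.
  by apply: eq_bigr => q _; exact/esym/linE.
apply: eq_trans (esym E) _; apply: eq_bigr => p _.
rewrite raddf_sum mulr_suml; apply: eq_bigr => q _; rewrite -mulrA.
exact: linE.
Qed.

Fact dual_mul1 : left_id dual1 dualM.
Proof.
move=> f; apply: dualP => x /=; rewrite -[RHS](congr1 f (counitl C x)).
rewrite /tsum raddf_sum; apply: eq_bigr => p _; apply/esym.
exact: (scalarZ f (counit C p.1) p.2).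
Qed.

Fact dual_mulr1 : right_id dual1 dualM.
Proof.
move=> f; apply: dualP => x /=; rewrite -[RHS](congr1 f (counitr C x)).
rewrite /tsum raddf_sum; apply: eq_bigr => p _; rewrite mulrC; apply/esym.
exact: (scalarZ f (counit C p.2) p.1).
Qed.

Fact dual_mulDl : left_distributive dualM +%R.
Proof.
move=> f g h; apply: dualP => x /=; rewrite /tsum -big_split.
by apply: eq_bigr => p _; rewrite /= mulrDl.
Qed.

Fact dual_mulDr : right_distributive dualM +%R.
Proof.
move=> f g h; apply: dualP => x /=; rewrite /tsum -big_split.
by apply: eq_bigr => p _; rewrite /= mulrDr.
Qed.

HB.instance Definition _ := GRing.Zmodule_isPzRing.Build D
  dual_mulA dual_mul1 dual_mulr1 dual_mulDl dual_mulDr.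

End Dual.

(* Formal (possibly infinite) series of functionals, summed pointwise; series f
   is 0 by convention when some value would be an infinite sum. *)

Section Series.
Variables (F : fieldType) (V : lmodType F) (C : coalgebra V) (I : choiceType).
Implicit Type f : I -> dual C.

Definition summable f := forall x, finite_set [set i | f i x != 0].

Fact series_scalar f : scalar (fun x : V =>
  if `[< summable f >] then \sum_(i \in [set: I]) f i x else 0).
Proof.
move=> a x y; case: asboolP => [sf|_]; last by rewrite mulr0 addr0.
have [fx fy] := (sf x, sf y).
pose S := fset_set ([set i | f i x != 0] `|` [set i | f i y != 0]).
have SP i : i \notin S -> f i x = 0 /\ f i y = 0.
  rewrite in_fset_set ?finite_setU// notin_setE /= => /not_orP[].
  by move=> /negP; rewrite negbK => /eqP-> /negP; rewrite negbK => /eqP->.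
rewrite !(@fsbigTE _ _ _ _ S).
- rewrite mulr_sumr -big_split; apply: eq_bigr => i _ /=.
  by rewrite linearP.
- by move=> i /SP[].
- by move=> i /SP[].
- by move=> i /SP[xi yi]; rewrite linearP xi yi mulr0 addr0.
Qed.

Definition series f : dual C := mkdual C (series_scalar f).

End Series.

Definition dual_exp (F : fieldType) (V : lmodType F) (C : coalgebra V)
    (f : dual C) : dual C :=
  series (fun n : nat => n`!%:R^-1 *: f ^+ n).

(* L is a right K-module algebra (act), K a left L-comodule coalgebra (coact),
   the fields counit_act to act_coact are Majid's compatibility conditions for
   a right-left bicrossproduct, and H is the resulting Hopf algebra, identified
   with K \ox L by bx_join; bx_join (k \ox l) is the element written kl. *)

Record bicrossproduct (F : fieldType) (K L H : algType F)
    (hK : hopf K) (hL : hopf L) (hH : hopf H) := Bicrossproduct {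
  act : {bilinear L -> K -> L};
  act1 : forall l, act l 1 = l;
  actM : forall l k k', act l (k * k') = act (act l k) k';
  act_unit : forall k, act 1 k = counit hK k *: 1;
  act_mul : forall l l' k,
    act (l * l') k = \tsum_(k1, k2 <- comul hK k) (act l k1 * act l' k2);
  coact : {linear K -> (L \ox K)%type};
  coact_counit : forall k, \tsum_(l, k' <- coact k) (counit hL l *: k') = k;
  coact_comul : forall k,
    \tsum_(l, k' <- coact k) \tsum_(l1, l2 <- comul hL l) (l1 \ox (l2 \ox k')) =
    \tsum_(l, k' <- coact k) \tsum_(l', k'' <- coact k') (l \ox (l' \ox k''));
  counit_coact : forall k,
    \tsum_(l, k' <- coact k) (counit hK k' *: l) = counit hK k *: 1;
  comul_coact : forall k,
    \tsum_(l, k' <- coact k) \tsum_(k1, k2 <- comul hK k') (l \ox (k1 \ox k2)) =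
    \tsum_(k1, k2 <- comul hK k)
      \tsum_(l1, k1' <- coact k1) \tsum_(l2, k2' <- coact k2)
        ((l1 * l2) \ox (k1' \ox k2'));
  counit_act : forall l k, counit hL (act l k) = counit hL l * counit hK k;
  comul_act : forall l k, comul hL (act l k) =
    \tsum_(l1, l2 <- comul hL l) \tsum_(k1, k2 <- comul hK k)
      \tsum_(l', k' <- coact k2) ((act l1 k1 * l') \ox act l2 k');
  coact1 : coact 1 = 1 \ox 1;
  coactM : forall k g, coact (k * g) =
    \tsum_(g1, g2 <- comul hK g)
      \tsum_(l, k' <- coact k) \tsum_(l', g' <- coact g2)
        ((act l g1 * l') \ox (k' * g'));
  act_coact : forall l k,
    \tsum_(k1, k2 <- comul hK k) \tsum_(l', k' <- coact k1)
      ((l' * act l k2) \ox k') =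
    \tsum_(k1, k2 <- comul hK k) \tsum_(l', k' <- coact k2)
      ((act l k1 * l') \ox k');
  bx_join : {linear (K \ox L)%type -> H};
  bx_split : {linear H -> (K \ox L)%type};
  bx_joinK : cancel bx_join bx_split;
  bx_splitK : cancel bx_split bx_join;
  bx_1 : bx_join (1 \ox 1) = 1;
  bx_mul : forall k l k' l', bx_join (k \ox l) * bx_join (k' \ox l') =
    \tsum_(k1, k2 <- comul hK k') bx_join ((k * k1) \ox (act l k2 * l'));
  bx_counit : forall k l,
    counit hH (bx_join (k \ox l)) = counit hK k * counit hL l;
  bx_comul : forall k l, comul hH (bx_join (k \ox l)) =
    \tsum_(k1, k2 <- comul hK k) \tsum_(l1, l2 <- comul hL l)
      \tsum_(l', k' <- coact k2)
        (bx_join (k1 \ox (l' * l1)) \ox bx_join (k' \ox l2))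
}.

Section Bicrossproduct.
Variables (F : fieldType) (K L H : algType F).
Variables (hK : hopf K) (hL : hopf L) (hH : hopf H).
Variable B : bicrossproduct hK hL hH.

Definition inK (k : K) : H := bx_join B (k \ox 1).
Definition inL (l : L) : H := bx_join B (1 \ox l).

(* K^* and L^* inside H^*: the functionals k \ox l |-> f k * counit l and
   k \ox l |-> counit k * f l. *)

Fact dual_inK_scalar (f : dual hK) :
  scalar (fun h => \tsum_(k, l <- bx_split B h) (f k * counit hL l)).
Proof.
have bil : bilinear_for *:%R *:%R (fun k l => f k * counit hL l : F^o).
  split=> [l a k k'|k a l l'] /=; rewrite linearP.
  - by rewrite mulrDl -mulrA.
  - by rewrite mulrDr mulrCA.
by move=> a x y; rewrite linearP (tsum_linear bil).
Qed.

Fact dual_inL_scalar (f : dual hL) :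
  scalar (fun h => \tsum_(k, l <- bx_split B h) (counit hK k * f l)).
Proof.
have bil : bilinear_for *:%R *:%R (fun k l => counit hK k * f l : F^o).
  split=> [l a k k'|k a l l'] /=; rewrite linearP.
  - by rewrite mulrDl -mulrA.
  - by rewrite mulrDr mulrCA.
by move=> a x y; rewrite linearP (tsum_linear bil).
Qed.

Definition dual_inK (f : dual hK) : dual hH := mkdual hH (dual_inK_scalar f).
Definition dual_inL (f : dual hL) : dual hH := mkdual hH (dual_inL_scalar f).

(* Hom_L(H, F), where L acts on the right of F through the character chi. *)

Variable chi : {lrmorphism L -> F | *%R}.

Definition coind_pred : {pred dual hH} :=
  fun f => `[< forall h l, f (h * inL l) = f h * chi l >].

Fact coind_submod_closed : submod_closed coind_pred.
Proof.
split=> [|a f g /asboolP fP /asboolP gP]; apply/asboolP=> h l /=.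
  by rewrite mul0r.
by rewrite fP gP mulrDl mulrA.
Qed.

HB.instance Definition _ :=
  GRing.isSubmodClosed.Build F (dual hH) coind_pred coind_submod_closed.

Record coind := Coind {coind_val :> dual hH; _ : coind_val \in coind_pred}.
HB.instance Definition _ := [isSub for coind_val].
HB.instance Definition _ := [Choice of coind by <:].
HB.instance Definition _ := [SubChoice_isSubLmodule of coind by <:].

Fact dual_act_scalar (f : dual hH) (h : H) : scalar (fun h' => f (h * h')).
Proof. by move=> a x y; rewrite mulrDr -scalerAr linearP. Qed.

Definition dual_act (f : dual hH) (h : H) : dual hH :=
  mkdual hH (dual_act_scalar f h).

Fact coind_act_subproof (f : coind) (h : H) :
  dual_act (coind_val f) h \in coind_pred.
Proof.
case: f => f /= /asboolP fP.
by apply/asboolP => h' l /=; rewrite mulrA fP.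
Qed.

Definition coind_act (f : coind) (h : H) : coind :=
  Coind (coind_act_subproof f h).

End Bicrossproduct.

Definition monomial (A : pzRingType) r (x : 'I_r -> A) (m : {ffun 'I_r -> nat}) :
  A := \prod_(i < r) x i ^+ m i.

Definition mfact r (m : {ffun 'I_r -> nat}) : nat := (\prod_(i < r) (m i)`!)%N.

Definition is_basis (F : fieldType) (V : lmodType F) (I : eqType) (b : I -> V) :=
  (forall v, exists (s : seq I) (c : I -> F), v = \sum_(i <- s) c i *: b i) /\
  (forall (s : seq I) (c : I -> F), uniq s ->
     \sum_(i <- s) c i *: b i = 0 -> {in s, forall i, c i = 0}).

(* Main.v *)
From HB Require Import structures.
Require Import Defs.
From mathcomp Require Import all_boot all_order all_algebra.
From mathcomp Require Import finmap.
From mathcomp Require Import all_classical all_reals.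
From mathcomp Require Import complex ring.

(* L is commutative with basis the monomials in the l_j, so it is a polynomial
   algebra and l_n |-> a_n extends to a character chi.  Expanding the
   exponentials, the duality pairing gives psi (k_m l_n) = delta_{m,0} a_n,
   that is, psi = counit_K * chi as a functional on K \ox L.  In general
   (x y) (k l) = x k * y l for x in K^* and y in L^*, hence
   (x psi) (k l) = x k * chi l.  Thus x |-> x psi and restriction to K are
   mutually inverse bijections between K^* and the functionals that are
   L-equivariant through chi, and the formula for the action only has to be
   compared on the basis k_m l_n, where a single term of the series survives. *)

Set Implicit Arguments.
Unset Strict Implicit.
Unset Printing Implicit Defensive.

Import GRing.Theory.
Local Open Scope ring_scope.

(** * Linear functionals prescribed on a basis *)

Section LinearExtension.
Variables (F : fieldType) (V : lmodType F) (I : eqType) (b : I -> V).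
Hypothesis bb : is_basis b.

Lemma basis_ind (P : V -> Prop) :
  P 0 -> (forall c x y, P x -> P y -> P (c *: x + y)) ->
  (forall i, P (b i)) -> forall x, P x.
Proof.
move=> P0 PL Pb x; have [s [c ->]] := bb.1 x.
elim: s => [|i s IH]; first by rewrite big_nil.
by rewrite big_cons; apply: PL.
Qed.

(** Repeated indices are allowed in the list, so that adding vectors amounts to concatenating
    lists. *)
Let eval (U : lmodType F) (A : I -> U) (t : seq (F * I)) : U :=
  \sum_(p <- t) p.1 *: A p.2.

(** Merging repeated indices gives the duplicate-free form in which [is_basis] expresses
    independence. *)
Let eval_collect (U : lmodType F) (A : I -> U) (t : seq (F * I)) :
  eval A t = \sum_(i <- undup [seq p.2 | p <- t])
    (\sum_(p <- t | p.2 == i) p.1) *: A i.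
Proof.
set u := undup _; under eq_bigr do rewrite scaler_suml.
rewrite (exchange_big_dep predT) //= [LHS]big_seq [RHS]big_seq.
apply: eq_bigr => p pt.
have pu : p.2 \in u by rewrite mem_undup map_f.
rewrite -big_filter (_ : [seq i <- u | p.2 == i] = [:: p.2]) ?big_seq1//.
under eq_filter do rewrite eq_sym.
by rewrite filter_pred1_uniq// undup_uniq.
Qed.

Let eval_wd (U : lmodType F) (A : I -> U) (t : seq (F * I)) :
  eval b t = 0 -> eval A t = 0.
Proof.
rewrite !eval_collect => /(bb.2 _ _ (undup_uniq _)) c0.
by rewrite big_seq big1// => i /c0 ->; rewrite scale0r.
Qed.

Let evalL (U : lmodType F) (A : I -> U) (c : F) (t : seq (F * I)) :
  eval A [seq (c * p.1, p.2) | p <- t] = c *: eval A t.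
Proof.
by rewrite /eval big_map scaler_sumr; apply: eq_bigr => p _; rewrite scalerA.
Qed.

Let evalD (U : lmodType F) (A : I -> U) (t u : seq (F * I)) :
  eval A (t ++ u) = eval A t + eval A u.
Proof. exact: big_cat. Qed.

Lemma basis_extension (A : I -> F) :
  exists f : {scalar V}, forall i, f (b i) = A i.
Proof.
have ex v : exists t, v = eval b t.
  have [s [c ->]] := bb.1 v; exists [seq (c i, i) | i <- s].
  by rewrite /eval big_map.
pose g v : F^o := eval (A : I -> F^o) (projT1 (cid (ex v))).
(* The list behind [g] comes from choice; [eval_wd], applied to the difference of two lists for the
   same vector, makes the value independent of it. *)
have gE t : g (eval b t) = eval (A : I -> F^o) t.
  rewrite /g; case: cid => u /= tu; apply/esym/eqP; rewrite -subr_eq0.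
  rewrite -scaleN1r -evalL -evalD; apply/eqP/eval_wd.
  by rewrite evalD evalL -tu scaleN1r subrr.
have lg : scalar (g : V -> F).
  move=> c x y; have [[t ->] [u ->]] := (ex x, ex y).
  by rewrite -evalL -evalD !gE evalD evalL.
exists (HB.pack_for {scalar V} (g : V -> F) (GRing.isLinear.Build F V F *%R _ lg)).
move=> i /=; have -> : b i = eval b [:: (1, i)].
  by rewrite /eval big_seq1 scale1r.
by rewrite gE /eval big_seq1 /= scale1r.
Qed.

End LinearExtension.

(** * Pointwise finite series and convolution *)

Section SeriesTheory.
Variables (F : fieldType) (V : lmodType F) (C : coalgebra V) (I : choiceType).
Implicit Types (f : I -> dual C) (S : seq I).

(** Summability rules out the default value 0 of [series]; any finite list covering the support at
    [x] then gives the sum. *)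
Lemma seriesE f S x : summable f -> uniq S ->
  (forall i, i \notin S -> f i x = 0) -> series f x = \sum_(i <- S) f i x.
Proof.
move=> sf uS fS; rewrite /= asboolT//.
rewrite (fsbigTE [fset i in S]%fset); last first.
  by move=> i; rewrite !inE => /fS.
by apply: perm_big; apply: uniq_perm => // i; rewrite !inE.
Qed.

Lemma summable_support f (xs : seq V) : summable f ->
  exists2 S, uniq S & forall x, x \in xs -> forall i, i \notin S -> f i x = 0.
Proof.
move=> sf; suff [S fS] : exists S, forall x, x \in xs ->
    forall i, i \notin S -> f i x = 0.
  exists (undup S); first exact: undup_uniq.
  by move=> x /fS {}fS i; rewrite mem_undup => /fS.
elim: xs => [|y xs [S IH]]; first by exists [::].
have /finite_seqP[T fT] := sf y; exists (T ++ S) => x.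
rewrite inE => xy i; rewrite mem_cat negb_or => /andP[iT iS].
case/predU1P: xy => [->|/IH]; last exact.
apply: contraNeq iT => fiy.
by have : [set` T]%classic i by rewrite -fT.
Qed.

(** At [x] the convolution sees [f i] only on finitely many vectors, the middle factors of the
    iterated coproduct of [x]; these have a common finite support. *)
Lemma summable_mul f (g h : dual C) : summable f ->
  summable (fun i => g * f i * h).
Proof.
move=> sf x.
pose xs := [seq q.2 | p <- repr (comul C x), q <- repr (comul C p.1)].
have [S _ fS] := summable_support xs sf.
apply: sub_finite_set (finite_seq S) => i /=; apply: contraNT => iS.
apply/eqP; rewrite /tsum big_seq big1// => p px.
rewrite big_seq big1 ?mul0r// => q qp; rewrite fS ?mulr0//.
by apply/allpairsPdep; exists p, q.
Qed.

(** Over that common support the series is a finite sum, which can be exchanged with the Sweedler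
    sums. *)
Lemma series_mul f (g h : dual C) : summable f ->
  g * series f * h = series (fun i => g * f i * h).
Proof.
move=> sf; apply: dualP => x.
pose xs := [seq q.2 | p <- repr (comul C x), q <- repr (comul C p.1)].
have [S uS fS] := summable_support xs sf.
have fSx p q : p \in repr (comul C x) -> q \in repr (comul C p.1) ->
    forall i, i \notin S -> f i q.2 = 0.
  by move=> px qp; apply: fS; apply/allpairsPdep; exists p, q.
rewrite (@seriesE _ S _ (summable_mul _ _ sf)) //; last first.
  move=> i iS; rewrite /= /tsum big_seq big1// => p px.
  by rewrite big_seq big1 ?mul0r// => q qp; rewrite (fSx p)// mulr0.
rewrite [LHS]/= /tsum [RHS]exchange_big big_seq [RHS]big_seq.
apply: eq_bigr => p px; rewrite -mulr_suml; congr (_ * _).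
rewrite exchange_big big_seq [RHS]big_seq; apply: eq_bigr => q qp.
rewrite -mulr_sumr; congr (_ * _); apply: seriesE => //.
exact: fSx px qp.
Qed.

End SeriesTheory.

Lemma series_single (F : fieldType) (V : lmodType F) (C : coalgebra V)
    (I : choiceType) (f : I -> dual C) i x : summable f ->
  (forall j, j != i -> f j x = 0) -> series f x = f i x.
Proof.
move=> sf f0; rewrite (@seriesE _ _ _ _ _ [:: i]) ?big_seq1// => j.
by rewrite inE => /f0.
Qed.

(** * Functionals on the bicrossproduct *)

Lemma scalarM_bilinear (F : fieldType) (V W : lmodType F)
    (f : {scalar V}) (g : {scalar W}) :
  bilinear_for *:%R *:%R (fun x y => f x * g y : F^o).
Proof.
by split=> [y a x x'|x a y y'] /=; rewrite linearP ?mulrDl -?mulrA// mulrDr mulrCA.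
Qed.

Section BicrossproductTheory.
Variables (F : fieldType) (K L H : algType F).
Variables (hK : hopf K) (hL : hopf L) (hH : hopf H).
Variable B : bicrossproduct hK hL hH.

Local Notation j k l := (bx_join B (k \ox l)).

Lemma join_bilinear : bilinear_for *:%R *:%R (fun k l => j k l).
Proof.
split=> [l a k k'|k a l l'] /=.
  by rewrite -linearP; congr (bx_join B _); exact: (pure_bilinear K L).1.
by rewrite -linearP; congr (bx_join B _); exact: (pure_bilinear K L).2.
Qed.

Lemma join_basis (I J : eqType) (b : I -> K) (c : J -> L) (P : H -> Prop) :
  is_basis b -> is_basis c ->
  P 0 -> (forall a x y, P x -> P y -> P (a *: x + y)) ->
  (forall i i', P (j (b i) (c i'))) -> forall h, P h.
Proof.
move=> bb bc P0 PL Pbc h; rewrite -(bx_splitK B h) [bx_split _ _]tensorE.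
rewrite /tsum linear_sum; apply: big_ind => //= [x y Px Py|[k l] _ /=].
  by rewrite -[x]scale1r; apply: PL.
(* Bilinearity at the scalar -1 and zero vectors reads [j 0 l' = - j 0 l' + j 0 l']. *)
have j0l l' : j 0 l' = 0.
  have := join_bilinear.1 l' (-1) 0 0.
  by rewrite /= !scaleN1r oppr0 addr0 addNr.
have jk0 k' : j k' 0 = 0.
  have := join_bilinear.2 k' (-1) 0 0.
  by rewrite /= !scaleN1r oppr0 addr0 addNr.
elim/(basis_ind bb): k => [|a x y Px Py|i]; first by rewrite j0l.
  by rewrite join_bilinear.1; apply: PL.
elim/(basis_ind bc): l => [|a x y Px Py|i']; first by rewrite jk0.
  by rewrite join_bilinear.2; apply: PL.
exact: Pbc.
Qed.

Lemma dual_basisP (I J : eqType) (b : I -> K) (c : J -> L) (f g : dual hH) :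
  is_basis b -> is_basis c ->
  (forall i i', f (j (b i) (c i')) = g (j (b i) (c i'))) -> f = g.
Proof.
move=> bb bc fg; apply: dualP; apply: (join_basis bb bc) => //.
  by rewrite !linear0.
by move=> a x y fx fy; rewrite !linearP fx fy.
Qed.

Lemma dual_joinP (f g : dual hH) :
  (forall k l, f (j k l) = g (j k l)) -> f = g.
Proof.
move=> fg; apply: dualP => h; rewrite -(bx_splitK B h) [bx_split _ _]tensorE.
by rewrite /tsum !linear_sum; apply: eq_bigr => p _; exact: fg.
Qed.

Lemma inKE (f : dual hK) k l : dual_inK B f (j k l) = f k * counit hL l.
Proof. by rewrite /= bx_joinK (tsum_pure (scalarM_bilinear f _)). Qed.

Lemma inLE (f : dual hL) k l : dual_inL B f (j k l) = counit hK k * f l.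
Proof. by rewrite /= bx_joinK (tsum_pure (scalarM_bilinear _ f)). Qed.

(** The right factor has K-component 1, whose coproduct [1 \ox 1] and trivial action reduce the
    product formula to one term. *)
Lemma join_mul_inL k l l' : j k l * inL B l' = j k (l * l').
Proof.
rewrite bx_mul comul1 (@tsum_pure _ _ _ _
  (fun k1 k2 => j (k * k1) (act B l k2 * l'))) ?mulr1 ?act1//.
split=> [y a x x'|x a y y'] /=.
  by rewrite mulrDr -scalerAr join_bilinear.1.
by rewrite linearPr mulrDl -scalerAl join_bilinear.2.
Qed.

Lemma joinE k l : j k l = inK B k * inL B l.
Proof. by rewrite join_mul_inL mul1r. Qed.

Lemma dualM_join (f g : dual hH) k l : (f * g) (j k l) =
  \tsum_(k1, k2 <- comul hK k) \tsum_(l1, l2 <- comul hL l)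
    \tsum_(l', k' <- coact B k2) (f (j k1 (l' * l1)) * g (j k' l2)).
Proof.
have bil := scalarM_bilinear f g.
(* The tensor product of [f] and [g] is packed as a linear map so that it passes through the nested
   sums of [bx_comul]. *)
pose lin : {linear (H \ox H)%type -> F^o} := HB.pack_for
  {linear (H \ox H)%type -> F^o} (tsum (fun x y => f x * g y : F^o))
  (GRing.isLinear.Build _ _ _ _ _ (tsum_linear bil)).
transitivity (lin (comul hH (j k l))) => //.
rewrite bx_comul [in LHS]/tsum linear_sum; apply: eq_bigr => p _.
rewrite linear_sum; apply: eq_bigr => q _.
rewrite linear_sum; apply: eq_bigr => t _.
exact: (tsum_pure bil).
Qed.

(** Both functionals are extended by counits, and [counitM] separates [l'] from [l1]; the three
    Sweedler sums then collapse by the counit axioms of L, of the coaction and of K. *)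
Lemma inK_mul_inL (f : dual hK) (g : dual hL) k l :
  (dual_inK B f * dual_inL B g) (j k l) = f k * g l.
Proof.
have gl : \tsum_(l1, l2 <- comul hL l) (counit hL l1 * g l2) = g l.
  rewrite -[in RHS](counitl hL l) /tsum linear_sum.
  by apply: eq_bigr => p _; rewrite linearZ.
have ek x : \tsum_(l', k' <- coact B x) (counit hL l' * counit hK k') =
    counit hK x.
  rewrite -[in RHS](coact_counit B x) /tsum linear_sum.
  by apply: eq_bigr => p _; rewrite linearZ.
have fk : \tsum_(k1, k2 <- comul hK k) (f k1 * counit hK k2) = f k.
  rewrite -[in RHS](counitr hK k) /tsum linear_sum.
  by apply: eq_bigr => p _; rewrite linearZ /= mulrC.
rewrite dualM_join -gl -fk /tsum mulr_suml; apply: eq_bigr => p _.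
rewrite mulr_sumr; apply: eq_bigr => q _.
rewrite -ek /tsum mulr_sumr mulr_suml; apply: eq_bigr => t _.
by rewrite inKE inLE counitM; ring.
Qed.

End BicrossproductTheory.

(** * Scalars, monomials and characters *)

Lemma dual_scalerAl (F : fieldType) (V : lmodType F) (C : coalgebra V)
    (c : F) (f g : dual C) : c *: f * g = c *: (f * g).
Proof.
apply: dualP => x; rewrite /= /tsum mulr_sumr.
by apply: eq_bigr => p _; rewrite mulrA.
Qed.

Lemma dual_scalerAr (F : fieldType) (V : lmodType F) (C : coalgebra V)
    (c : F) (f g : dual C) : f * (c *: g) = c *: (f * g).
Proof.
apply: dualP => x; rewrite /= /tsum mulr_sumr.
by apply: eq_bigr => p _; rewrite mulrCA.
Qed.

Lemma dual_exprZ (F : fieldType) (V : lmodType F) (C : coalgebra V)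
    (c : F) (f : dual C) n : (c *: f) ^+ n = c ^+ n *: f ^+ n.
Proof.
elim: n => [|n IH]; first by rewrite !expr0 scale1r.
by rewrite !exprS IH dual_scalerAl dual_scalerAr scalerA.
Qed.

Lemma monomial0 (A : pzRingType) r (x : 'I_r -> A) :
  monomial x [ffun=> 0%N] = 1.
Proof. by rewrite /monomial big1// => i _; rewrite ffunE. Qed.

Lemma monomialD (A : pzRingType) r (x : 'I_r -> A) (m n : {ffun 'I_r -> nat}) :
  (forall y z : A, y * z = z * y) ->
  monomial x m * monomial x n = monomial x [ffun i => (m i + n i)%N].
Proof.
move=> comA; rewrite /monomial -prodrM_comm; last by move=> i i' _ _; exact: comA.
by apply: eq_bigr => i _; rewrite ffunE exprD.
Qed.

(** Isolates one factor of a noncommutative product with the others kept in order. The lists depend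
    only on [t], so different products share one splitting. *)
Lemma prod_split (I : finType) (t : I) : exists r1 r2 : seq I,
  [/\ t \notin r1, t \notin r2 & forall (A : pzRingType) (G : I -> A),
    \prod_i G i = \prod_(i <- r1) G i * G t * \prod_(i <- r2) G i].
Proof.
have [r1 [r2 def]] : exists r1 r2, index_enum I = r1 ++ t :: r2.
  by case/splitPr: (mem_index_enum t) => r1 r2; exists r1, r2.
have := index_enum_uniq I; rewrite def cat_uniq /=.
move=> /and3P[_ /norP[tr1 _] /andP[tr2 _]].
by exists r1, r2; split=> // A G; rewrite big_cat big_cons /= mulrA.
Qed.

(** Commutativity turns a product of monomials into the monomial with added exponents, so the linear
    extension is multiplicative on the basis, hence everywhere. *)
Lemma character_exists (F : fieldType) (L : algType F) s (l : 'I_s -> L)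
    (a : 'I_s -> F) :
  (forall x y : L, x * y = y * x) -> is_basis (monomial l) ->
  exists chi : {lrmorphism L -> F | *%R},
    forall n, chi (monomial l n) = monomial a n.
Proof.
move=> comL bl; have [f fl] := basis_extension bl (monomial a).
have f1 : f 1 = 1 by rewrite -(monomial0 l) fl monomial0.
have fM : {morph f : x y / x * y}.
  move=> x y; elim/(basis_ind bl): x => [|c x x' fx fx'|m].
  - by rewrite mul0r linear0 mul0r.
  - by rewrite mulrDl -scalerAl !linearP fx fx' /= mulrDl mulrA.
  elim/(basis_ind bl): y => [|c y y' fy fy'|n].
  - by rewrite mulr0 linear0 mulr0.
  - by rewrite mulrDr -scalerAr !linearP fy fy' /= mulrDr mulrCA.
  by rewrite monomialD// !fl monomialD//; exact: mulrC.
by exists (HB.pack_for {lrmorphism L -> F | *%R} (f : L -> F) f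
  (GRing.isMonoidMorphism.Build L F f (conj f1 fM))).
Qed.

(** * Pairing monomials with the exponentials *)

Section Pairing.
Variables (F : fieldType) (K L H : algType F).
Variables (hK : hopf K) (hL : hopf L) (hH : hopf H).
Variable B : bicrossproduct hK hL hH.
Hypothesis charF : [pchar F] =i pred0.
Variables (r s : nat) (k : 'I_r -> K) (l : 'I_s -> L).
Variables (kappa : 'I_r -> dual hK) (lambda : 'I_s -> dual hL).
Hypothesis bk : is_basis (monomial k).
Hypothesis bl : is_basis (monomial l).
Local Notation kap := (monomial (fun i => dual_inK B (kappa i))).
Local Notation lam := (fun i => dual_inL B (lambda i)).
Local Notation kl m n := (bx_join B (monomial k m \ox monomial l n)).
Hypothesis pairing : forall m n m' n', (kap m' * monomial lam n') (kl m n) =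
  (mfact m)%:R * (mfact n)%:R * (m' == m)%:R * (n' == n)%:R.
Variable a : 'I_s -> F.

(** Vanishing outside a finite list passes to linear combinations by concatenating lists, so basis
    vectors suffice. *)
Lemma summable_kl (I : choiceType) (f : I -> dual hH) :
  (forall m n, exists S : seq I, forall i, i \notin S -> f i (kl m n) = 0) ->
  summable f.
Proof.
move=> fb x; suff [S fS] : exists S : seq I, forall i, i \notin S -> f i x = 0.
  apply: sub_finite_set (finite_seq S) => i /=.
  by apply: contraNT => /fS/eqP.
apply: (join_basis (B := B) bk bl (P := fun x => exists S : seq I,
  forall i, i \notin S -> f i x = 0)) => // [|c {}x y [S fx] [T fy]].
  by exists [::] => i _; rewrite linear0.
exists (S ++ T) => i; rewrite mem_cat negb_or linearP => /andP[/fx-> /fy->].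
by rewrite mulr0 addr0.
Qed.

(** The unit of the dual algebra is the counit of [H], so the pairing with the zero exponents
    computes the counit. *)
Lemma counit_monomial m :
  counit hK (monomial k m) = (mfact m)%:R * ([ffun=> 0%N] == m)%:R.
Proof.
have := pairing m [ffun=> 0%N] [ffun=> 0%N] [ffun=> 0%N].
rewrite !monomial0 mul1r eqxx mulr1 bx_counit counit1 mulr1 => ->.
by rewrite /mfact (big1 _ _ (fun i : 'I_s => _))//= ?mulr1// => i _; rewrite ffunE.
Qed.

Lemma summable_exp i :
  summable (fun N => N`!%:R^-1 *: (a i *: dual_inL B (lambda i)) ^+ N).
Proof.
apply: summable_kl => m n; exists [:: n i] => N; rewrite inE => Nn.
(* Written as a full monomial, the power falls under [pairing], which leaves only [N = n i]. *)
have lamE : dual_inL B (lambda i) ^+ N =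
    kap [ffun=> 0%N] * monomial lam [ffun j => if j == i then N else 0%N].
  rewrite monomial0 mul1r /monomial (big_only1 i)//= ?ffunE ?eqxx//.
  by move=> j /negPf ji _; rewrite ffunE ji.
rewrite dual_exprZ lamE /= -/(dualM _ _) [X in _ * (_ * X)]pairing.
rewrite (_ : (_ == n) = false) ?mulr0//; apply: contraNF Nn => /eqP <-.
by rewrite ffunE eqxx.
Qed.

(** Interpolates between the monomial with exponents [p] at [t = 0] and the product of exponentials
    at [t = s]. *)
Let pfactor (t : nat) (p : {ffun 'I_s -> nat}) (i : 'I_s) : dual hH :=
  if (i < t)%N then dual_exp (a i *: dual_inL B (lambda i))
  else dual_inL B (lambda i) ^+ p i.

(** The share of index [i] in the value at [l_n]; for an exponential, the factorial from the pairing
    has cancelled against the series coefficient. *)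
Let pvalue (t : nat) (p n : {ffun 'I_s -> nat}) (i : 'I_s) : F :=
  if (i < t)%N then a i ^+ n i else (n i)`!%:R * (p i == n i)%:R.

(* Convolution need not commute, so the powers of the lambda_i are replaced by
   exponentials one index at a time, keeping the order of the factors. *)
Let pairing_partial t p m n m' : (t <= s)%N ->
  (kap m' * \prod_i pfactor t p i) (kl m n) =
  (mfact m)%:R * (m' == m)%:R * \prod_i pvalue t p n i.
Proof.
elim: t p => [|t IH] p ts.
  have -> : \prod_i pfactor 0 p i = monomial lam p by [].
  rewrite pairing [X in X * _]mulrAC -[LHS]mulrA; congr (_ * _).
  rewrite (eq_bigr (fun i => (n i)`!%:R * (p i == n i)%:R))// big_split /=.
  rewrite /mfact natr_prod; congr (_ * _).
  case: eqP => [->|/eqP pn]; first by rewrite big1// => i _; rewrite eqxx.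
  have [i pi] : exists i, p i != n i.
    apply/existsP; apply: contraNT pn => /existsPn pn.
    by apply/eqP/ffunP => i; apply/eqP; have := pn i; rewrite negbK.
  by rewrite (bigD1 i)//= (negPf pi) mul0r.
(* [tt] is the index whose power becomes an exponential; [upd N] puts there the exponent of the
   [N]-th series term, and the induction hypothesis covers every exponent vector. *)
pose tt := Ordinal ts; pose upd N := [ffun i => if i == tt then N else p i].
have ltE i : i != tt -> (i < t.+1)%N = (i < t)%N.
  by move=> itt; rewrite ltnS leq_eqVlt -[(i : nat) == t]/(i == tt) (negPf itt).
have [r1 [r2 [tr1 tr2 prodE]]] := prod_split tt.
pose P1 := \prod_(i <- r1) pfactor t.+1 p i.
pose P2 := \prod_(i <- r2) pfactor t.+1 p i.
have updE N : P1 * dual_inL B (lambda tt) ^+ N * P2 = \prod_i pfactor t (upd N) i.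
  have E (q : seq 'I_s) : tt \notin q ->
      \prod_(i <- q) pfactor t.+1 p i = \prod_(i <- q) pfactor t (upd N) i.
    move=> tq; apply: eq_big_seq => i iq.
    have itt : i != tt by apply: contraNneq tq => <-.
    by rewrite /pfactor ltE// ffunE (negPf itt).
  by rewrite prodE /P1 /P2 !E// [pfactor _ _ tt]/pfactor ltnn ffunE eqxx.
have termE N : (kap m' * P1 *
      (N`!%:R^-1 *: (a tt *: dual_inL B (lambda tt)) ^+ N) * P2) (kl m n) =
    (N`!%:R^-1 * a tt ^+ N) *
    ((mfact m)%:R * (m' == m)%:R * \prod_i pvalue t (upd N) n i).
  rewrite dual_exprZ !dual_scalerAr !dual_scalerAl scalerA -IH ?(ltnW ts)//.
  by rewrite -updE !mulrA.
have pvalueE N : \prod_i pvalue t (upd N) n i = (n tt)`!%:R * (N == n tt)%:R *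
    \prod_(i | i != tt) pvalue t.+1 p n i.
  rewrite (bigD1 tt)//= [pvalue _ _ _ tt]/pvalue ltnn ffunE eqxx; congr (_ * _).
  by apply: eq_bigr => i itt; rewrite /pvalue ltE// ffunE (negPf itt).
rewrite prodE -/P1 -/P2 [pfactor _ _ tt]/pfactor ltnSn !mulrA.
rewrite series_mul; last exact: summable_exp.
(* Only the term [N = n tt] survives, and its inverse factorial cancels the factorial from the
   pairing. *)
rewrite (@series_single _ _ _ _ _ (n tt)).
- rewrite termE pvalueE eqxx mulr1 [in RHS](bigD1 tt)//= [pvalue _ _ _ tt]/pvalue ltnSn.
  have : (n tt)`!%:R != 0 :> F by rewrite ((pcharf0P _).1 charF) -lt0n fact_gt0.
  by move=> ?; field.
- exact: summable_mul (summable_exp _).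
- by move=> N /negPf Nn; rewrite termE pvalueE Nn !(mulr0, mul0r).
Qed.

Local Notation psi :=
  (\prod_(i < s) dual_exp (a i *: dual_inL B (lambda i)) : dual hH).

Lemma pairing_exp m n m' : (kap m' * psi) (kl m n) =
  (mfact m)%:R * (m' == m)%:R * monomial a n.
Proof.
(* At stage [s] every factor is an exponential, so any exponent vector serves. *)
have := pairing_partial [ffun=> 0%N] m n m' (leqnn s).
rewrite (eq_bigr (fun i => dual_exp (a i *: dual_inL B (lambda i)))); last first.
  by move=> i _; rewrite /pfactor ltn_ord.
move=> ->; congr (_ * _); apply: eq_bigr => i _.
by rewrite /pvalue ltn_ord.
Qed.

(** * The induced module *)

Variable chi : {lrmorphism L -> F | *%R}.
Hypothesis chil : forall n, chi (monomial l n) = monomial a n.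

(** At [m' = 0] the K-part of [pairing_exp] is the counit of [k_m], by [counit_monomial], and its
    L-part is [chi]. *)
Lemma prod_exp_inL : psi = dual_inL B (chi : {scalar L}).
Proof.
apply: (dual_basisP (B := B) bk bl) => m n.
have := pairing_exp m n [ffun=> 0%N].
by rewrite monomial0 mul1r => ->; rewrite inLE -counit_monomial -chil.
Qed.

Lemma inK_mul_psi x k' l' :
  (dual_inK B x * psi) (bx_join B (k' \ox l')) = x k' * chi l'.
Proof. by rewrite prod_exp_inL inK_mul_inL. Qed.

Lemma inK_mul_psi_coind x : dual_inK B x * psi \in coind_pred B chi.
Proof.
apply/asboolP => h l'; apply: (join_basis (B := B) bk bl (P := fun h =>
  (dual_inK B x * psi) (h * inL B l') = (dual_inK B x * psi) h * chi l')).
- by rewrite mul0r !linear0 mul0r.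
- move=> c y z IHy IHz.
  by rewrite mulrDl -scalerAl !linearP IHy IHz mulrDl mulrA.
- by move=> m n; rewrite join_mul_inL !inK_mul_psi rmorphM mulrA.
Qed.

Fact restrictK_scalar (f : dual hH) : scalar (fun x : K => f (inK B x)).
Proof. by move=> c x y; rewrite /inK (join_bilinear B).1 linearP. Qed.

Definition restrictK (f : dual hH) : dual hK := mkdual hK (restrictK_scalar f).

(** Equivariance gives f(kl) = f(k) chi(l), so the restriction to K determines [f]. *)
Lemma restrictK_coind f : f \in coind_pred B chi ->
  f = dual_inK B (restrictK f) * psi.
Proof.
move=> /asboolP fP; apply: (dual_joinP (B := B)) => k' l'.
by rewrite inK_mul_psi joinE fP.
Qed.

Lemma restrictK_inK_mul_psi x : restrictK (dual_inK B x * psi) = x.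
Proof. by apply: dualP => k' /=; rewrite [LHS]inK_mul_psi rmorph1 mulr1. Qed.

Fact coind_of_linear :
  linear (fun x => Coind (inK_mul_psi_coind x) : coind B chi).
Proof.
move=> c x y; apply: val_inj; apply: (dual_joinP (B := B)) => k' l'.
rewrite [LHS]inK_mul_psi.
(* The operations of [coind] are pointwise, so this equality holds by computation. *)
transitivity (c * (dual_inK B x * psi) (bx_join B (k' \ox l')) +
  (dual_inK B y * psi) (bx_join B (k' \ox l'))) => //.
by rewrite !inK_mul_psi /= mulrDl mulrA.
Qed.

Lemma coind_isomorphism : exists Phi : {linear dual hK -> coind B chi},
  bijective Phi /\ forall x, coind_val (Phi x) = dual_inK B x * psi.
Proof.
exists (HB.pack_for {linear dual hK -> coind B chi}
  (fun x => Coind (inK_mul_psi_coind x))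
  (GRing.isLinear.Build _ _ _ _ _ coind_of_linear)); split=> //.
exists (fun f => restrictK (coind_val f)) => [x|f].
  exact: restrictK_inK_mul_psi.
by apply: val_inj; apply/esym/restrictK_coind; case: f.
Qed.

Lemma coind_act_series (f : coind B chi) (h : H) :
  let term m : dual hH :=
    coind_val f (h * ((mfact m)%:R^-1 *: inK B (monomial k m))) *: kap m * psi in
  summable term /\ coind_val (coind_act f h) = series term.
Proof.
move=> term.
have termE m' m n : term m' (kl m n) =
    coind_val f (h * ((mfact m')%:R^-1 *: inK B (monomial k m'))) *
    ((mfact m)%:R * (m' == m)%:R * monomial a n).
  by rewrite /term dual_scalerAl -pairing_exp.
have st : summable term.
  apply: summable_kl => m n; exists [:: m] => m'; rewrite inE => /negPf m'm.
  by rewrite termE m'm !(mulr0, mul0r).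
split=> //; apply: (dual_basisP (B := B) bk bl) => m n.
rewrite (@series_single _ _ _ _ _ m)//; last first.
  by move=> m' /negPf m'm; rewrite termE m'm !(mulr0, mul0r).
(* The [m!] from the pairing is to cancel the inverse in the coefficient, while equivariance
   extracts [chi] of [l_n] on the left. *)
rewrite termE eqxx mulr1 -scalerAr linearZ /= joinE mulrA.
have /asboolP -> : coind_val f \in coind_pred B chi := valP f.
rewrite chil; have m0 : (mfact m)%:R != 0 :> F.
  by rewrite ((pcharf0P _).1 charF) -lt0n prodn_gt0// => i; exact: fact_gt0.
by field.
Qed.

End Pairing.

Theorem theorem3p1 (R : realType) (K : algType R[i]) (L H : algType R[i])
    (hK : hopf K) (hL : hopf L) (hH : hopf H) (B : bicrossproduct hK hL hH)
    (r s : nat) (k : 'I_r -> K) (l : 'I_s -> L)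
    (kappa : 'I_r -> dual hK) (lambda : 'I_s -> dual hL) :
    cocommutative hK ->
    (forall x y : L, x * y = y * x) ->
    (forall i, primitive hK (k i)) ->
    is_basis (monomial k) ->
    is_basis (monomial l) ->
    (forall m n m' n',
      (monomial (fun i => dual_inK B (kappa i)) m' *
       monomial (fun j => dual_inL B (lambda j)) n')
        (bx_join B (monomial k m \ox monomial l n)) =
      (mfact m)%:R * (mfact n)%:R * (m' == m)%:R * (n' == n)%:R) ->
  forall a : 'I_s -> R[i],
    (exists chi : {lrmorphism L -> R[i] | *%R},
      forall n, chi (monomial l n) = monomial a n) /\
    forall chi : {lrmorphism L -> R[i] | *%R},
      (forall n, chi (monomial l n) = monomial a n) ->
    let psi : dual hH :=
      \prod_(j < s) dual_exp (a j *: dual_inL B (lambda j)) in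
    [/\ exists Phi : {linear dual hK -> coind B chi}, bijective Phi /\
          forall x, coind_val (Phi x) = dual_inK B x * psi,
        forall f : dual hH,
          f \in coind_pred B chi <-> exists x : dual hK, f = dual_inK B x * psi
      & forall (f : coind B chi) (h : H),
        let term m : dual hH :=
          coind_val f (h * ((mfact m)%:R^-1 *: inK B (monomial k m))) *:
            monomial (fun i => dual_inK B (kappa i)) m * psi in
        summable term /\ coind_val (coind_act f h) = series term].
Proof.
move=> _ comL _ bk bl pairing a; split; first exact: character_exists.
(* Characteristic 0 makes the factorials invertible. *)
move=> chi chil psi; have charC := Num.Theory.pchar_num R[i]; split.
- exact: (coind_isomorphism charC bk bl pairing chil).
- move=> f; split=> [fP|[x ->]]; last exact: (inK_mul_psi_coind charC bk bl pairing chil).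
  by exists (restrictK B f); exact: (restrictK_coind charC bk bl pairing chil).
- exact: (coind_act_series charC bk bl pairing chil).
Qed.
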